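(* Let $(S,\cdot,\ast)$ be a regular $\star$-semigroup. Define binary operations $+$ and $\oplus$ on $S$ by $a+b=aba^{\ast}$ and $a\oplus b=b^{\ast}ab$ for all $a,b\in S$. Let $\boxplus$ denote either one of $+$, $\oplus$. Then (for each of the two choices of $\boxplus$) the following statements are equivalent: (1) $x(y\boxplus z)=xy\boxplus x(x^{\ast}\boxplus z)$ for all $x,y,z\in S$. (2) $(z\boxplus y)x=(z\boxplus x^{\ast})x\boxplus yx$ for all $x,y,z\in S$. (3) $(S,\cdot)$ is commutative. If (3) holds, then $(S,\boxplus)$ is a semigroup. Thus $(S,\boxplus,\cdot,\ast)$ is a left (or equivalently, right; or equivalently, two-sided) regular $\star$-semibrace if and only if $(S,\cdot)$ is commutative.
   Context: A regular $\star$-semigroup is a triple $(S,\cdot,\ast)$ where $(S,\cdot)$ is a semigroup on a non-empty set and $\ast:S\to S$, $x\mapsto x^\ast$, satisfies $xx^\ast x=x$, $(x^\ast)^\ast=x$, $(xy)^\ast=y^\ast x^\ast$ for all $x,y\in S$. Let $(S,\boxplus,\cdot,\ast)$ be such that $(S,\boxplus)$ is a semigroup and $(S,\cdot,\ast)$ is a regular $\star$-semigroup. It is a left regular $\star$-semibrace if $x(y\boxplus z)=xy\boxplus x(x^{\ast}\boxplus z)$ for all $x,y,z\in S$; a right regular $\star$-semibrace if $(z\boxplus y)x=(z\boxplus x^{\ast})x\boxplus yx$ for all $x,y,z\in S$; two-sided if both hold. Multiplication has precedence over $+$, $\oplus$, $\boxplus$. *)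

(* Defs.v *)
From mathcomp Require Import all_boot.

Set Implicit Arguments.
Unset Strict Implicit.
Unset Printing Implicit Defensive.

(* Operations are explicit rather than bundled: two semigroup operations live
   on the same carrier, and MathComp's [semigroupType] would require the
   carrier to be a [choiceType]. *)

Definition is_semigroup (S : Type) (op : S -> S -> S) : Prop :=
  inhabited S /\ associative op.

Record is_regular_star_semigroup (S : Type) (mul : S -> S -> S)
    (star : S -> S) : Prop := RegularStarSemigroup {
  rss_semigroup : is_semigroup mul;
  rss_regular : forall x, mul (mul x (star x)) x = x;
  rss_involutive : forall x, star (star x) = x;
  rss_antimorph : forall x y, star (mul x y) = mul (star y) (star x)
}.

Section Semibrace.

Variables (S : Type) (box mul : S -> S -> S) (star : S -> S).

Local Notation "x ⊞ y" := (box x y) (at level 50, left associativity).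
Local Notation "x · y" := (mul x y) (at level 40, left associativity).
Local Notation "x ^⋆" := (star x) (at level 2, format "x ^⋆").

Definition left_semibrace_law : Prop :=
  forall x y z, x · (y ⊞ z) = x · y ⊞ x · (x^⋆ ⊞ z).

Definition right_semibrace_law : Prop :=
  forall x y z, (z ⊞ y) · x = (z ⊞ x^⋆) · x ⊞ y · x.

Definition is_left_semibrace : Prop :=
  [/\ is_semigroup box, is_regular_star_semigroup mul star
    & left_semibrace_law].

Definition is_right_semibrace : Prop :=
  [/\ is_semigroup box, is_regular_star_semigroup mul star
    & right_semibrace_law].

Definition is_two_sided_semibrace : Prop :=
  is_left_semibrace /\ is_right_semibrace.

Definition star_plus (a b : S) : S := a · b · a^⋆.

Definition star_oplus (a b : S) : S := b^⋆ · a · b.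

End Semibrace.

(* Main.v *)
(** The opposite multiplication exchanges [+] with the flip of [⊕] and left laws
    with right laws, so only [+] needs work. Either law for [+] forces
    [x x* w = x x* w x x*], hence (applying the star) every projection [x x*] is
    central. The semigroup is then Clifford, a strong semilattice of groups, and
    one specialisation of the law, cancelled as in a group up to central
    projections, yields [xy = yx]. *)
Require Import Defs.
From mathcomp Require Import all_boot.

Section StarPlus.

Variables (S : Type) (mul : S -> S -> S) (star : S -> S).
Hypothesis hS : is_regular_star_semigroup mul star.

Local Notation "x · y" := (mul x y) (at level 40, left associativity).
Local Notation "x ^⋆" := (star x) (at level 2, format "x ^⋆").

Let mulA : associative mul. Proof. by case: hS => -[]. Qed.
Let starK : involutive star. Proof. exact: rss_involutive hS. Qed.
Let starM x y : (x · y)^⋆ = y^⋆ · x^⋆. Proof. exact: rss_antimorph hS _ _. Qed.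
Let mulKs x : x · x^⋆ · x = x. Proof. exact: rss_regular hS _. Qed.
Let mulsK x : x^⋆ · x · x^⋆ = x^⋆.
Proof. by rewrite -{2}[x]starK mulKs. Qed.
Let mulKsr u x : u · x · x^⋆ · x = u · x.
Proof. by rewrite -!(mulA u) mulKs. Qed.

(** Since the star fixes [x · x^⋆], starring the hypothesis at [w^⋆] shows that [w · x · x^⋆] equals
    the same two-sided product. *)
Lemma projections_central :
    (forall x w, x · x^⋆ · w = x · x^⋆ · w · x · x^⋆) ->
  forall x w, x · x^⋆ · w = w · x · x^⋆.
Proof.
move=> absorb x w; rewrite absorb.
by have /(congr1 star) := absorb x w^⋆; rewrite !starM !starK !mulA => ->.
Qed.

Section CentralProjections.

Hypothesis central : forall x w, x · x^⋆ · w = w · x · x^⋆.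

(** By centrality the two projections commute, and their product collapses to one of them in each
    order. So [x^⋆] inverts [x] in a subgroup with identity [x · x^⋆]. *)
Let projC x : x^⋆ · x = x · x^⋆.
Proof.
have e1 : x · x^⋆ · x^⋆ · x = x^⋆ · x by rewrite central mulsK.
have e2 : x^⋆ · x · x · x^⋆ = x · x^⋆.
  by have := central x^⋆ x; rewrite starK mulKs => ->.
by have := central x (x^⋆ · x); rewrite !mulA e1 e2.
Qed.

Let centralr u x w : u · x · x^⋆ · w = u · w · x · x^⋆.
Proof. by rewrite -!(mulA u) central. Qed.
Let projCr u x : u · x^⋆ · x = u · x · x^⋆.
Proof. by rewrite -!mulA projC. Qed.
Let mulKKs x : x · x · x^⋆ = x.
Proof. by rewrite -central mulKs. Qed.
Let mulsKr u x : u · x · x^⋆ · x^⋆ = u · x^⋆.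
Proof. by rewrite centralr -!(mulA u) mulsK. Qed.

(** The hypothesis is the left law for [+], multiplied out. *)
Lemma comm_of_left_law :
    (forall x y z, x · y · z · y^⋆ = x · y · x · x^⋆ · z · x · y^⋆ · x^⋆) ->
  commutative mul.
Proof.
move=> law.
(* Taking [z = y^⋆ · x^⋆] makes every [y] on either side cancel against a [y^⋆]. *)
have conj x y : x · x^⋆ · y^⋆ = x · y^⋆ · x^⋆.
  have := law x y (y^⋆ · x^⋆); rewrite !mulA.
  rewrite (centralr x y x^⋆) mulsKr (centralr (x · y) x y^⋆) mulsKr.
  by rewrite (centralr x y x^⋆) (centralr _ y x) mulKs mulsKr.
have swap x y : y^⋆ · x = x · y^⋆.
  have := congr1 (mul^~ x) (conj x y).
  by rewrite /= projCr central mulKsr -(centralr x x) mulKKs.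
by move=> x y; rewrite -[y]starK swap.
Qed.

Lemma comm_of_right_law :
    (forall x y z, z · y · z^⋆ · x
       = z · x^⋆ · z^⋆ · x · y · x · x^⋆ · z · x · z^⋆) ->
  commutative mul.
Proof.
move=> law x z.
(* The choice [y = x^⋆ · z] in the law makes both sides collapse by moving projections. *)
have conj : z · x · x^⋆ = z · x^⋆ · z · x · z^⋆.
  have lhs : z · x^⋆ · z · z^⋆ · x = z · x · x^⋆.
    by rewrite centralr projCr centralr (centralr _ x) mulKKs.
  have rhs : z · x^⋆ · z^⋆ · x · x^⋆ · z · x · x^⋆ · z · x · z^⋆
      = z · x^⋆ · z · x · z^⋆.
    rewrite (centralr _ x z) mulKsr 2!(centralr _ x z) mulKsr.
    by rewrite projCr mulKsr.
  by have := law x (x^⋆ · z) z; rewrite !mulA lhs rhs.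
(* Left multiplication by [x · z^⋆] clears the leading [z · x^⋆] on the right, leaving a plain
   conjugation of [x] by [z]. *)
have {}conj : x · z · z^⋆ = z · x · z^⋆.
  have lhs : x · z^⋆ · z · x · x^⋆ = x · z · z^⋆.
    by rewrite projCr -2!(centralr _ x) mulKKs.
  have rhs : x · z^⋆ · z · x^⋆ · z · x · z^⋆ = z · x · z^⋆.
    by rewrite projCr (centralr x z x^⋆) mulKsr central mulKsr.
  by have := congr1 (fun u => x · (z^⋆ · u)) conj; rewrite /= !mulA lhs rhs.
have := congr1 (mul^~ z) conj.
by rewrite /= mulKsr => ->; rewrite projCr -centralr mulKKs.
Qed.

End CentralProjections.

(** A pointwise specification also covers the flip of [star_oplus] over the reversed product, which
    matches [star_plus] only up to associativity. *)
Variable box : S -> S -> S.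
Hypothesis boxE : forall a b, box a b = a · b · a^⋆.

Lemma left_semibrace_law_comm : left_semibrace_law box mul star -> commutative mul.
Proof.
move=> lawL.
have law x y z : x · y · z · y^⋆ = x · y · x · x^⋆ · z · x · y^⋆ · x^⋆.
  by have := lawL x y z; rewrite !boxE starM starK !mulA.
(* The right side of [law] ends in [x^⋆], which absorbs [x · x^⋆]. *)
have law_absorb x y z : x · y · z · y^⋆ = x · y · z · y^⋆ · x · x^⋆.
  by rewrite law -(mulA _ x^⋆ x) -(mulA _ (x^⋆ · x)) mulsK.
have sqr x : x = x · x · x^⋆.
  by have := law_absorb x x^⋆ (x · x^⋆); rewrite starK !mulA !mulKs.
have sqrr u w : u · w · w · w^⋆ = u · w by rewrite -!(mulA u) -sqr.
apply: comm_of_left_law => //; apply: projections_central => x w.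
(* The first slot is a projection, and the repeated [w] lets [sqrr] shorten the left side to
   [x · x^⋆ · w]. *)
have := law_absorb (x · x^⋆) w w.
by rewrite sqrr starM starK !mulA mulKsr.
Qed.

Lemma right_semibrace_law_comm : right_semibrace_law box mul star -> commutative mul.
Proof.
move=> lawR.
have law x y z : z · y · z^⋆ · x
    = z · x^⋆ · z^⋆ · x · y · x · x^⋆ · z · x · z^⋆.
  by have := lawR x y z; rewrite !boxE !starM !starK !mulA.
(* With [y = z^⋆ · z] the left side of [law] is [z · z^⋆ · x], while the right side ends in [z^⋆]
   and so absorbs [z · z^⋆]. *)
have absorb z x : z · z^⋆ · x = z · z^⋆ · x · z · z^⋆.
  have := law x (z^⋆ · z) z; rewrite !mulA !mulKs => e.
  by rewrite e -!(mulA _ z^⋆) -!mulA [z^⋆ · (z · z^⋆)]mulA mulsK.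
exact: comm_of_right_law (projections_central absorb) law.
Qed.

Section Commutative.

Hypothesis mulC : commutative mul.

Let mulAC : right_commutative mul.
Proof. by move=> x y z; rewrite -!mulA (mulC y). Qed.
Let absorbC x w : x · w · x · x^⋆ = x · w.
Proof. by rewrite (mulAC x w) (mulAC _ w) (mulAC x x) mulKs. Qed.

Lemma comm_left_semibrace_law : left_semibrace_law box mul star.
Proof.
move=> x y z; rewrite !boxE starM starK !mulA absorbC.
by rewrite (mulAC _ y^⋆ x^⋆) -(mulA x y z) absorbC.
Qed.

Lemma comm_right_semibrace_law : right_semibrace_law box mul star.
Proof.
move=> x y z; rewrite !boxE !starM !starK !mulA.
(* The right side has three [x], two [x^⋆], and two each of [z] and [z^⋆]; regularity leaves one
   [x], one [z] and one [z^⋆] beside [y]. *)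
rewrite [in RHS](mulAC _ x z^⋆) -5![in RHS](mulA z) absorbC !mulA mulKsr.
rewrite (mulAC _ x^⋆ z^⋆) (mulAC _ x^⋆ x) (mulAC _ x^⋆ y) (mulAC _ x^⋆ x).
rewrite (mulAC _ y x) (mulAC _ y x^⋆) (mulAC _ x x^⋆) mulKsr.
by rewrite (mulAC _ x y) (mulAC _ z^⋆ y).
Qed.

Lemma comm_box_semigroup : is_semigroup box.
Proof.
split; first by case: hS => -[].
move=> a b c; rewrite !boxE !starM !starK !mulA.
rewrite [RHS](mulAC _ b^⋆ a^⋆) -2![in RHS](mulA a) absorbC !mulA.
by rewrite (mulAC _ a^⋆ c) (mulAC _ a^⋆ b^⋆).
Qed.

End Commutative.

End StarPlus.

Lemma regular_star_semigroup_op (S : Type) (mul : S -> S -> S) (star : S -> S) :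
  is_regular_star_semigroup mul star ->
  is_regular_star_semigroup (fun x y => mul y x) star.
Proof.
case=> -[inhS mulA] mulKs starK starM.
by split=> // [|x]; [split=> // x y z; rewrite mulA | rewrite mulA].
Qed.

Lemma star_box_semibrace_laws (S : Type) (mul : S -> S -> S) (star : S -> S)
    (hS : is_regular_star_semigroup mul star) (box : S -> S -> S)
    (hbox : box = star_plus mul star \/ box = star_oplus mul star) :
  [/\ left_semibrace_law box mul star -> commutative mul,
      right_semibrace_law box mul star -> commutative mul
    & commutative mul ->
      [/\ is_semigroup box, left_semibrace_law box mul star
        & right_semibrace_law box mul star]].
Proof.
case: hbox => ->.
  have boxE a b : star_plus mul star a b = mul (mul a b) (star a) by [].
  split.
  - exact: (left_semibrace_law_comm _ _ _ hS _ boxE).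
  - exact: (right_semibrace_law_comm _ _ _ hS _ boxE).
  - move=> mulC; split.
    + exact: (comm_box_semigroup _ _ _ hS _ boxE).
    + exact: (comm_left_semibrace_law _ _ _ hS _ boxE).
    + exact: (comm_right_semibrace_law _ _ _ hS _ boxE).
have hop := regular_star_semigroup_op _ _ _ hS.
have boxE a b :
    star_oplus mul star b a = (fun x y => mul y x) (mul b a) (star a).
  by case: hS => -[_ mulA] _ _ _; rewrite /star_oplus -mulA.
split.
- move=> lawL x y; exact: (right_semibrace_law_comm _ _ _ hop _ boxE lawL y x).
- move=> lawR x y; exact: (left_semibrace_law_comm _ _ _ hop _ boxE lawR y x).
- move=> mulC; have opC : commutative (fun x y => mul y x) by move=> x y.
  split.
  + have [inhS boxA] := comm_box_semigroup _ _ _ hop _ boxE opC.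
    by split=> // a b c; rewrite [RHS]boxA.
  + exact: (comm_right_semibrace_law _ _ _ hop _ boxE opC).
  + exact: (comm_left_semibrace_law _ _ _ hop _ boxE opC).
Qed.

Theorem proposition3p10 (S : Type) (mul : S -> S -> S) (star : S -> S)
    (hS : is_regular_star_semigroup mul star)
    (box : S -> S -> S)
    (hbox : box = star_plus mul star \/ box = star_oplus mul star) :
  [/\ [<-> left_semibrace_law box mul star;
           right_semibrace_law box mul star;
           commutative mul],
      commutative mul -> is_semigroup box,
      is_left_semibrace box mul star <-> commutative mul,
      is_right_semibrace box mul star <-> commutative mul
    & is_two_sided_semibrace box mul star <-> commutative mul].
Proof.
have [lawL_comm lawR_comm comm_laws] := star_box_semibrace_laws _ _ _ hS _ hbox.
split.
- by tfae=> [/lawL_comm/comm_laws[] | /lawR_comm | /comm_laws[]].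
- by case/comm_laws.
- by split=> [[_ _ /lawL_comm] | /comm_laws[]].
- by split=> [[_ _ /lawR_comm] | /comm_laws[]].
- by split=> [[[_ _ /lawL_comm]] | /comm_laws[]].
Qed.
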